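(* For every $n\ge 0$, the number $|\mathrm{Cay}_{\mathrm{Der}}[n]|$ of fixed-point-free Cayley permutations of $[n]$ is $$|\mathrm{Cay}_{\mathrm{Der}}[n]| \,=\, \sum_{r=0}^n\frac{|\mathrm{Der}[r]|}{r!}\sum_{i=0}^n i!\left\{\frac{n}{i}\right\}_r .$$
   Context: $[n]=\{1,\dots,n\}$, $[0]=\emptyset$. A Cayley permutation of $[n]$ is a function $f:[n]\to[n]$ with $\mathrm{Im}(f)=[k]$ for some $k\le n$; it is fixed-point-free if $f(u)\ne u$ for all $u\in[n]$. $|\mathrm{Der}[r]|=r!\sum_{i=0}^r(-1)^i/i!$ is the number of derangements (fixed-point-free permutations) of $[r]$. For $n,m,r\ge 0$, the $r$-Stirling number of the second kind $\left\{{n\atop m}\right\}_r$ is the number of set partitions of $[n]$ into $m$ blocks such that $1,2,\dots,r$ lie in distinct blocks, with the convention that it is $0$ if $r>n$. Define $$\left\{\frac{n}{m}\right\}_r=\left\{{n\atop m}\right\}_r-\left\{{n\atop m}\right\}_{r+1}.$$ *)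

(* Defs.v *)
From mathcomp Require Import all_boot all_order all_fingroup all_algebra.
Set Implicit Arguments.
Unset Strict Implicit.
Unset Printing Implicit Defensive.
Import GRing.Theory.

(* The set [n] = {1, ..., n} is represented by 'I_n = {0, ..., n-1}, the
   element u of [n] being the ordinal u - 1; in particular [k], for k <= n, is
   the set of the j : 'I_n such that j < k. *)

Definition fixed_point_free (T : finType) (f : T -> T) : bool :=
  [forall u, f u != u].

Definition is_cayley n (f : {ffun 'I_n -> 'I_n}) : bool :=
  [exists k : 'I_n.+1, [set f u | u : 'I_n] == [set j : 'I_n | j < k]].

Definition CayDer n : {set {ffun 'I_n -> 'I_n}} :=
  [set f | is_cayley f & fixed_point_free f].

Definition Der r : {set 'S_r} := [set s : 'S_r | fixed_point_free s].

(* The conjunct r <= n is the convention that the number is 0 for r > n. *)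
Definition rStirling2 (r n m : nat) : nat :=
  #|[set P : {set {set 'I_n}} |
      [&& r <= n, partition P [set: 'I_n], #|P| == m &
          [forall i : 'I_n, forall j : 'I_n,
             [&& i < r, j < r & i != j] ==> (pblock P i != pblock P j)]]]|.

Definition rStirling2_diff (r n m : nat) : int :=
  ((rStirling2 r n m)%:Z - (rStirling2 r.+1 n m)%:Z)%R.

(* Main.v *)
(* For a fixed image [k], inclusion-exclusion over the set S of fixed points
   reduces the count to the surjections [n] -> [k] fixing S pointwise. Their
   kernels are the partitions of [n] into k blocks separating S, each arising
   from (k - |S|)! of them; conjugating by a permutation of [k] allows one to
   take S = [r]. Hence there are k! sum_r (-1)^r/r! {n,k}_r fixed-point-free
   Cayley permutations with image [k]. As (-1)^r/r! is the difference of
   consecutive values of |Der[r]|/r!, Abel summation gives the formula. *)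
Require Import Defs.
From mathcomp Require Import all_boot all_order all_fingroup all_algebra.
From mathcomp Require Import ring.
Set Implicit Arguments.
Unset Strict Implicit.
Unset Printing Implicit Defensive.
Import GRing.Theory Num.Theory.

(** * Fixed points, and transport by permutations of a set *)

Definition fixed_points (T : finType) (f : T -> T) : {set T} :=
  [set u | f u == u].

(** The partitions behind the r-Stirling numbers, with an arbitrary [S] in place of [r]:
    inclusion-exclusion meets every set of fixed points. *)
Definition separating_partitions (T : finType) (S : {set T}) (m : nat) :
    {set {set {set T}}} :=
  [set P | [&& partition P [set: T], #|P| == m & dinjectiveb (pblock P) S]].

Definition surj_fixing (T : finType) (K S : {set T}) : {set {ffun T -> T}} :=
  [set f : {ffun T -> T} | ([set f u | u : T] == K) && (S \subset fixed_points f)].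

Lemma fixed_points_eq0 (T : finType) (f : T -> T) :
  (fixed_points f == set0) = fixed_point_free f.
Proof.
apply/eqP/forallP => [f0 u|fpf].
  by apply/negP => fu; move: (in_set0 u); rewrite -f0 inE fu.
by apply/setP => u; rewrite !inE (negbTE (fpf u)).
Qed.

Lemma fixed_pointsP (T : finType) (f : T -> T) (S : {set T}) :
  reflect {in S, forall u, f u = u} (S \subset fixed_points f).
Proof.
apply: (iffP subsetP) => fS u uS; last by rewrite inE fS.
by have := fS u uS; rewrite inE => /eqP.
Qed.

(** Equal kernels on [S] make [g u |-> h u] a well-defined partial injection of [K], and such an
    injection extends to a permutation of [K]. *)
Lemma perm_on_transport (I : finType) (T : finType) (K : {set T})
    (S : {set I}) (g h : I -> T) :
    {in S, forall u, g u \in K} -> {in S, forall u, h u \in K} ->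
    {in S &, forall u v, (g u == g v) = (h u == h v)} ->
  exists2 s : {perm T}, perm_on K s & {in S, forall u, s (g u) = h u}.
Proof.
have [n] := ubnP #|S|; elim: n S => // n IH S; rewrite ltnS => Sn gK hK gh.
have [->|[a aS]] := set_0Vmem S.
  by exists 1%g; [exact: perm_on1 | move=> u; rewrite inE].
have sub u : u \in S :\ a -> u \in S by case/setD1P.
have [||||s sK sS] := IH (S :\ a).
- by apply: leq_trans Sn; apply/proper_card/properD1.
- by move=> u /sub; apply: gK.
- by move=> u /sub; apply: hK.
- by move=> u v /sub uS /sub vS; apply: gh.
have [/existsP[v /andP[vS /eqP gv]]|/existsPn new] :=
    boolP [exists v, (v \in S :\ a) && (g v == g a)].
  exists s => // u uS; have [->|ua] := eqVneq u a; last by rewrite sS // !inE ua.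
  by rewrite -gv sS //; apply/eqP; rewrite -(gh _ _ (sub _ vS) aS) gv.
(* The value [g a] is new, and so is [h a]; the transposition therefore corrects the image of [g a]
   without disturbing the values already matched. *)
exists (s * tperm (s (g a)) (h a))%g.
  apply: perm_onM => //; apply: subset_trans (tperm_on _ _) _.
  by rewrite subUset !sub1set hK // perm_closed // gK.
move=> u uS; rewrite permM; have [->|ua] := eqVneq u a; first by rewrite tpermL.
have uSa : u \in S :\ a by rewrite !inE ua.
have gua : g a != g u by have := new u; rewrite uSa eq_sym.
by rewrite tpermD ?(inj_eq perm_inj) // sS // -gh.
Qed.

(** * Kernels of maps as set partitions *)

Lemma eq_kernel_card_imset (T : finType) (U V : finType) (f : T -> U)
    (g : T -> V) (A : {set T}) :
  {in A &, forall u v, (f u == f v) = (g u == g v)} ->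
  #|[set f u | u in A]| = #|[set g u | u in A]|.
Proof.
move=> fg; have [->|[a aA]] := set_0Vmem A; first by rewrite !imset0 !cards0.
(* [r] chooses preimages under [g] (the default [a] serves only off the image), so [f \o r] is a
   bijection from the image of [g] to that of [f]. *)
pose r y := odflt a [pick u in A | g u == y].
have rP y : y \in [set g u | u in A] -> r y \in A /\ g (r y) = y.
  case/imsetP=> u uA ->; rewrite /r; case: pickP => [v /andP[vA /eqP]//|/(_ u)].
  by rewrite uA eqxx.
have -> : [set f u | u in A] = [set (f \o r) y | y in [set g u | u in A]].
  apply/setP => x; apply/imsetP/imsetP => [[u uA ->]|[y yA ->]].
    exists (g u); first exact: imset_f.
    have [ruA gru] := rP (g u) (imset_f g uA).
    by apply/eqP; rewrite /= fg // gru.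
  by have [ryA _] := rP y yA; exists (r y).
rewrite card_in_imset // => y z yA zA /= /eqP.
by have [ryA gy] := rP y yA; have [rzA gz] := rP z zA; rewrite fg // gy gz => /eqP.
Qed.

Lemma pblock_preim_partition (T : finType) (rT : eqType) (f : T -> rT) (u v : T) :
  (pblock (preim_partition f [set: T]) u ==
     pblock (preim_partition f [set: T]) v) = (f u == f v).
Proof.
have /and3P[/eqP cov tI _] := preim_partitionP f [set: T].
rewrite eq_pblock ?cov ?inE //.
rewrite pblock_equivalence_partition ?inE //.
by move=> x y z _ _ _; split=> [|/eqP->].
Qed.

Lemma preim_partition_eqP (T : finType) (rT : eqType) (f : T -> rT)
    (P : {set {set T}}) : partition P [set: T] ->
  reflect (forall u v, (pblock P u == pblock P v) = (f u == f v))
          (preim_partition f [set: T] == P).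
Proof.
move=> partP; apply: (iffP eqP) => [<- u v|kerP].
  exact: pblock_preim_partition.
rewrite -(preim_partition_pblock partP) /preim_partition /equivalence_partition.
by apply: eq_imset => u; apply/setP=> v; rewrite !inE kerP.
Qed.

Lemma imset_pblock (T : finType) (P : {set {set T}}) :
  partition P [set: T] -> [set pblock P u | u : T] = P.
Proof.
case/and3P=> /eqP cov tI P0; apply/setP => B; apply/imsetP/idP => [[u _ ->]|BP].
  by rewrite pblock_mem // cov.
have [B0|[u uB]] := set_0Vmem B; first by rewrite -B0 BP in P0.
by exists u; rewrite // (def_pblock tI BP uB).
Qed.

Lemma card_preim_partition (T rT : finType) (f : T -> rT) :
  #|preim_partition f [set: T]| = #|[set f u | u : T]|.
Proof.
rewrite -(imset_pblock (preim_partitionP f [set: T])).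
pose e := pblock_preim_partition f.
have := @eq_kernel_card_imset T _ _ _ f [set: T] (fun u v _ _ => e u v).
congr (_ = _); apply: eq_card => x; apply/imsetP/imsetP => -[u _ ->]; by exists u.
Qed.

(** * Surjections fixing [S], sorted by kernel *)

Lemma separating_partitions_leq (T : finType) (S : {set T}) m P :
  P \in separating_partitions S m -> #|S| <= m.
Proof.
rewrite inE => /and3P[partP /eqP <- /dinjectiveP injP].
rewrite -(card_in_imset injP) -{2}(imset_pblock partP).
by apply/subset_leq_card/subsetP => _ /imsetP[u _ ->]; apply: imset_f.
Qed.

Lemma surj_fixing_separates (T : finType) (K S : {set T}) f :
  f \in surj_fixing K S ->
  preim_partition f [set: T] \in separating_partitions S #|K|.
Proof.
rewrite !inE => /andP[/eqP <- /fixed_pointsP fS].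
rewrite preim_partitionP card_preim_partition eqxx /=.
apply/dinjectiveP => u v uS vS /eqP; rewrite pblock_preim_partition !fS //.
by move/eqP.
Qed.

Lemma surj_fixing_with_kernel (T : finType) (K S : {set T}) P :
  S \subset K -> P \in separating_partitions S #|K| ->
  exists2 f, f \in surj_fixing K S & preim_partition f [set: T] = P.
Proof.
move=> /subsetP SK; rewrite inE => /and3P[partP /eqP cardP /dinjectiveP injP].
have imP := imset_pblock partP.
have [cov _ _] := and3P partP.
have blockP u : pblock P u \in P by rewrite pblock_mem // (eqP cov).
(* Label each block by the element of [K] of the same rank; the default is never reached, as there
   are as many blocks as elements of [K]. *)
pose g u := nth u (enum K) (index (pblock P u) (enum P)).
have gidx u : index (pblock P u) (enum P) < size (enum K).
  by rewrite -cardE -cardP cardE index_mem mem_enum.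
have gK u : g u \in K by rewrite -mem_enum mem_nth.
have ker_g u v : (pblock P u == pblock P v) = (g u == g v).
  rewrite /g (set_nth_default u v) // nth_uniq ?enum_uniq //.
  apply/eqP/eqP => [-> //|e]; have := congr1 (nth (pblock P u) (enum P)) e.
  by rewrite !nth_index ?mem_enum.
(* Elements of [S] lie in distinct blocks, so [g] is injective on [S] and the labels can be permuted
   to make [S] fixed. *)
have [|||s sK sS] := @perm_on_transport T T K S g id.
- by move=> u _; apply: gK.
- exact: SK.
- move=> u v uS vS; rewrite -ker_g; apply/eqP/eqP => [|-> //]; exact: injP.
exists [ffun u => s (g u)]; last first.
  by apply/eqP/preim_partition_eqP => // u v; rewrite !ffunE (inj_eq perm_inj).
rewrite inE; apply/andP; split; last by apply/fixed_pointsP => u uS; rewrite ffunE sS.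
rewrite eqEcard; apply/andP; split.
  by apply/subsetP => _ /imsetP[u _ ->]; rewrite ffunE perm_closed.
rewrite -card_preim_partition -cardP; apply: eq_leq; congr #|pred_of_set _|; apply/esym/eqP.
by apply/preim_partition_eqP => // u v; rewrite !ffunE (inj_eq perm_inj).
Qed.

(* Surjections onto K with a given kernel form a torsor under the permutations
   of K; fixing S pointwise cuts the group down to the permutations of K :\: S. *)
Lemma card_surj_fixing_kernel (T : finType) (K S : {set T}) P :
  S \subset K -> P \in separating_partitions S #|K| ->
  #|[set f in surj_fixing K S | preim_partition f [set: T] == P]|
    = (#|K| - #|S|)`!.
Proof.
move=> SK PS; have partP : partition P setT by move: PS; rewrite inE => /andP[].
have [f0 f0F /eqP/preim_partition_eqP] := surj_fixing_with_kernel SK PS.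
move/(_ partP) => ker0; move: f0F; rewrite inE => /andP[/eqP im0 /fixed_pointsP fix0].
have -> : #|K| - #|S| = #|K :\: S| by rewrite cardsD (setIidPr SK).
rewrite -card_perm.
pose comp (s : {perm T}) := [ffun u => s (f0 u)].
rewrite -(@card_in_imset _ _ comp); last first.
  move=> s t sK tK /ffunP st; apply/permP => x.
  have [|xK] := boolP (x \in K).
    by rewrite -im0 => /imsetP[u _ ->]; have := st u; rewrite !ffunE.
  have xKS : x \notin K :\: S by rewrite inE (negbTE xK) andbF.
  by rewrite !(out_perm _ xKS).
apply: eq_card => f; apply/idP/imsetP => [|[s sKS ->]].
  rewrite !inE => /andP[/andP[/eqP imf /fixed_pointsP fixf]].
  move=> /(preim_partition_eqP _ partP) kerf.
  have [|||s sK sf] := @perm_on_transport T T K setT f0 f.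
  - by move=> u _; rewrite -im0 imset_f.
  - by move=> u _; rewrite -imf imset_f.
  - by move=> u v _ _; rewrite -ker0 kerf.
  exists s; last by apply/ffunP => u; rewrite ffunE sf ?inE.
  (* Both [f0] and [f] are the identity on [S], hence so is [s], and its support shrinks from [K] to
     [K :\: S]. *)
  rewrite unfold_in; apply/subsetP => x sx; rewrite inE (subsetP sK) // andbT.
  apply: contra sx => xS; rewrite -{1}(fix0 _ xS) sf ?inE // fixf //.
have sK : perm_on K s by apply: subset_trans sKS (subsetDl _ _).
rewrite !inE -andbA; apply/and3P; split.
- apply/eqP/setP => y; apply/imsetP/idP => [[u _ ->]|yK].
    by rewrite ffunE perm_closed // -im0 imset_f.
  have : s^-1%g y \in K by rewrite perm_closed // perm_onV.
  rewrite -im0 => /imsetP[u _ e]; exists u => //.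
  by rewrite ffunE -e permKV.
- apply/fixed_pointsP => u uS; rewrite ffunE fix0 //.
  by apply: (out_perm sKS); rewrite inE uS.
- by apply/preim_partition_eqP => // u v; rewrite !ffunE (inj_eq perm_inj).
Qed.

Lemma card_surj_fixing_separating (T : finType) (K S : {set T}) :
  S \subset K ->
  #|surj_fixing K S| = #|separating_partitions S #|K| | * (#|K| - #|S|)`!.
Proof.
move=> SK; rewrite -sum_nat_const -sum1_card.
rewrite (partition_big (fun f : {ffun T -> T} => preim_partition f setT)
   (mem (separating_partitions S #|K|))); last first.
  by move=> f; apply: surj_fixing_separates.
apply: eq_bigr => P PS; rewrite -(card_surj_fixing_kernel SK PS) -sum1_card.
by apply: eq_bigl => f; rewrite inE.
Qed.

(** * Conjugation between fixed sets of equal size *)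

Lemma perm_on_imset (T : finType) (K A B : {set T}) :
  A \subset K -> B \subset K -> #|A| = #|B| ->
  exists2 s : {perm T}, perm_on K s & [set s x | x in A] = B.
Proof.
move=> /subsetP AK /subsetP BK AB.
pose h x := nth x (enum B) (index x (enum A)).
have hidx x : x \in A -> index x (enum A) < size (enum B).
  by move=> xA; rewrite -cardE -AB cardE index_mem mem_enum.
have hB x : x \in A -> h x \in B by move=> xA; rewrite -mem_enum mem_nth ?hidx.
have [|||s sK sA] := @perm_on_transport T T K A id h.
- exact: AK.
- by move=> x /hB; apply: BK.
- move=> x y xA yA; rewrite /h (set_nth_default x y) ?hidx //.
  rewrite nth_uniq ?enum_uniq ?hidx //.
  apply/eqP/eqP => [-> //|e]; have := congr1 (nth x (enum A)) e.
  by rewrite !nth_index ?mem_enum.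
exists s => //; apply/eqP; rewrite eqEcard card_imset ?AB ?leqnn ?andbT; last exact: perm_inj.
by apply/subsetP => _ /imsetP[x xA ->]; rewrite sA ?hB.
Qed.

(** Conjugating by a permutation of [K] that carries [A] to [B] is injective and preserves the image
    [K]. Equality then follows by symmetry. *)
Lemma leq_card_surj_fixing (T : finType) (K A B : {set T}) :
  A \subset K -> B \subset K -> #|A| = #|B| ->
  #|surj_fixing K A| <= #|surj_fixing K B|.
Proof.
move=> AK BK AB; have [s sK sAB] := perm_on_imset AK BK AB.
pose conj (f : {ffun T -> T}) := [ffun u => s (f (s^-1%g u))].
have conj_inj : injective conj.
  move=> f g /ffunP fg; apply/ffunP => u; have := fg (s u).
  by rewrite !ffunE !permK => /perm_inj.
rewrite -(card_imset _ conj_inj); apply/subset_leq_card/subsetP => g /imsetP[f].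
rewrite !inE => /andP[/eqP imf /fixed_pointsP fixf] ->; apply/andP; split.
  rewrite -(im_perm_on sK) -imf -imset_comp; apply/eqP/setP => y.
  apply/imsetP/imsetP => -[u _ ->]; last by exists (s u); rewrite // ffunE permK.
  by exists (s^-1%g u); rewrite // ffunE.
apply/fixed_pointsP => y; rewrite -sAB => /imsetP[x xA ->].
by rewrite ffunE permK fixf.
Qed.

Lemma eq_card_surj_fixing (T : finType) (K A B : {set T}) :
  A \subset K -> B \subset K -> #|A| = #|B| ->
  #|surj_fixing K A| = #|surj_fixing K B|.
Proof. by move=> AK BK AB; apply/eqP; rewrite eqn_leq !leq_card_surj_fixing. Qed.

(** * Passage to the r-Stirling numbers *)

Lemma card_initial_segment n k : k <= n -> #|[set j : 'I_n | j < k]| = k.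
Proof.
move=> kn; have winj : injective (widen_ord kn) by move=> i j /(congr1 val) /= /val_inj.
rewrite -[RHS]card_ord -(card_imset _ winj).
apply: eq_card => j; rewrite inE; apply/idP/imsetP => [jk|[i _ ->]//=].
by exists (Ordinal jk) => //; apply: val_inj.
Qed.

Lemma rStirling2_separating r n m : r <= n ->
  rStirling2 r n m = #|separating_partitions [set j : 'I_n | j < r] m|.
Proof.
move=> rn; apply: eq_card => P; rewrite !inE rn /=; congr [&& _, _ & _].
apply/forallP/dinjectiveP => [sepP i j|injP i].
  rewrite !inE => ir jr eqP_ij; apply/eqP/negPn/negP => ij.
  by have /forallP/(_ j) := sepP i; rewrite ir jr ij eqP_ij eqxx.
apply/forallP => j; apply/implyP => /and3P[ir jr]; apply: contra => /eqP e.
by apply/eqP/injP; rewrite ?inE.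
Qed.

Lemma rStirling2_small r n m : n < r -> rStirling2 r n m = 0.
Proof.
by move=> nr; apply/eqP; rewrite cards_eq0; apply/eqP/setP => P; rewrite !inE leqNgt nr.
Qed.

Lemma rStirling2_few_blocks r n m : r <= n -> m < r -> rStirling2 r n m = 0.
Proof.
move=> rn mr; rewrite rStirling2_separating //; apply: eq_card0 => P.
apply/negP => /separating_partitions_leq; rewrite card_initial_segment //.
by rewrite leqNgt mr.
Qed.

Lemma card_surj_fixing_rStirling2 n k (S : {set 'I_n}) :
  k <= n -> S \subset [set j : 'I_n | j < k] ->
  #|surj_fixing [set j : 'I_n | j < k] S| = rStirling2 #|S| n k * (k - #|S|)`!.
Proof.
move=> kn SK; have Sk : #|S| <= k.
  by rewrite -(card_initial_segment kn) subset_leq_card.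
have Sn := leq_trans Sk kn; have cK := card_initial_segment kn.
rewrite (@eq_card_surj_fixing _ _ S [set j : 'I_n | j < #|S|]) ?card_initial_segment //.
  rewrite card_surj_fixing_separating ?cK ?card_initial_segment //.
    by rewrite rStirling2_separating.
  by apply/subsetP => j; rewrite !inE => jS; apply: leq_trans Sk.
by apply/subsetP => j; rewrite !inE => jS; apply: leq_trans Sk.
Qed.

(** * Inclusion-exclusion, for permutations and for surjections *)

Lemma card_perm_fixing r (S : {set 'I_r}) :
  #|[set s : 'S_r | S \subset fixed_points s]| = (r - #|S|)`!.
Proof.
have -> : r - #|S| = #|~: S| by rewrite [RHS]cardsCs setCK card_ord.
rewrite -card_perm; apply: eq_card => s.
rewrite inE unfold_in; apply/fixed_pointsP/subsetP => [sS x|sS u uS].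
  by rewrite !inE; apply: contra => /sS ->.
by apply/eqP/negPn/negP => /(sS u); rewrite inE uS.
Qed.

Local Open Scope ring_scope.

Lemma natr_fact_neq0 (F : numDomainType) m : m`!%:R != 0 :> F.
Proof. by rewrite pnatr_eq0 -lt0n fact_gt0. Qed.

Lemma sum_subsets_card (V : nmodType) (T : finType) (K : {set T}) (a : nat -> V) :
  \sum_(S : {set T} | S \subset K) a #|S| = \sum_(j < #|K|.+1) a j *+ 'C(#|K|, j).
Proof.
(* Group the subsets by size; [inord] is exact because a subset of [K] has at most [#|K|]
   elements. *)
rewrite (partition_big (fun S : {set T} => inord #|S| : 'I_#|K|.+1) xpredT) //.
apply: eq_bigr => j _; rewrite -cards_draws -sumr_const.
apply: eq_big => S => [|/andP[SK /eqP <-]].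
  rewrite inE; apply: andb_id2l => SK.
  by rewrite -val_eqE /= inordK // ltnS subset_leq_card.
by rewrite inordK // ltnS subset_leq_card.
Qed.

(** This is the binomial expansion of [(1 - 1) ^+ #|A|], with [0 ^+ 0 = 1] for the empty set. *)
Lemma sum_subsets_sign (T : finType) (A : {set T}) :
  \sum_(S : {set T} | S \subset A) (-1) ^+ #|S| = (A == set0)%:R :> rat.
Proof.
rewrite (sum_subsets_card A (fun j => (-1) ^+ j)) -cards_eq0 -expr0n.
rewrite -[X in X ^+ _](subrr (1 : rat)) exprDn.
by apply: eq_bigr => j _; rewrite expr1n mul1r.
Qed.

(* Inclusion-exclusion, when the number of x in X with S \subset F x depends
   only on the size of S. *)
Lemma inclusion_exclusion (X T : finType) (A : {set X}) (K : {set T})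
    (F : X -> {set T}) (a : nat -> nat) :
    {in A, forall x, F x \subset K} ->
    (forall S : {set T}, S \subset K -> #|[set x in A | S \subset F x]| = a #|S|) ->
  #|[set x in A | F x == set0]|%:R =
    \sum_(j < #|K|.+1) (-1) ^+ j * (a j)%:R *+ 'C(#|K|, j) :> rat.
Proof.
move=> FK aP; rewrite -(sum_subsets_card K (fun j => (-1) ^+ j * (a j)%:R)).
(* The indicator of [F x == set0] is an alternating sum over the subsets of [F x]; the two sums are
   then exchanged. *)
transitivity (\sum_(x in A) \sum_(S : {set T} | S \subset F x) (-1) ^+ #|S| : rat).
  under eq_bigr do rewrite sum_subsets_sign.
  rewrite -natr_sum -sum1_card big_mkcond [in RHS]big_mkcond.
  by congr (_%:R); apply: eq_bigr => x _; rewrite inE; case: (x \in A) (_ == _) => -[].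
rewrite (exchange_big_dep (fun S : {set T} => S \subset K)) /=; last first.
  by move=> x S xA /subset_trans -> //; apply: FK.
apply: eq_bigr => S SK; rewrite -aP // sumr_const mulr_natr.
by congr (_ *+ _); apply: eq_card => x; rewrite !inE.
Qed.

(** There are (r - j)! permutations fixing j given points, and C(r, j) (r - j)! / r! = 1 / j!. *)
Lemma card_Der r :
  #|Der r|%:R / r`!%:R = \sum_(0 <= j < r.+1) (-1) ^+ j / j`!%:R :> rat.
Proof.
have := @inclusion_exclusion _ _ [set: 'S_r] [set: 'I_r]
  (fun s => fixed_points s) (fun j => (r - j)`!).
rewrite cardsT card_ord => IE.
have -> : #|Der r| = #|[set s in [set: 'S_r] | fixed_points s == set0]|.
  by apply: eq_card => s; rewrite !inE fixed_points_eq0.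
rewrite IE; first last.
- by move=> S _; rewrite -card_perm_fixing; apply: eq_card => s; rewrite !inE.
- by move=> s _; apply: subsetT.
rewrite big_mkord big_distrl /=; apply: eq_bigr => j _.
have jr : (j <= r)%N by rewrite -ltnS.
rewrite -mulr_natr -(bin_fact jr) !natrM.
have := natr_fact_neq0 rat j; have := natr_fact_neq0 rat (r - j).
have : 'C(r, j)%:R != 0 :> rat by rewrite pnatr_eq0 -lt0n bin_gt0.
by move=> ? ? ?; field; apply/and3P.
Qed.

Lemma card_fpf_surj n k : (k <= n)%N ->
  #|[set f : {ffun 'I_n -> 'I_n} | ([set f u | u : 'I_n] == [set j : 'I_n | j < k]%N)
       && fixed_point_free f]|%:R =
    k`!%:R * \sum_(0 <= r < n.+1) (-1) ^+ r / r`!%:R * (rStirling2 r n k)%:R :> rat.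
Proof.
move=> kn; set K := [set j : 'I_n | (j < k)%N].
have cK : #|K| = k by apply: card_initial_segment.
have := @inclusion_exclusion _ _
  [set f : {ffun 'I_n -> 'I_n} | [set f u | u : 'I_n] == K] K
  (fun f => fixed_points f) (fun j => rStirling2 j n k * (k - j)`!)%N.
rewrite cK => IE.
transitivity (#|[set f in [set f : {ffun 'I_n -> 'I_n} | [set f u | u : 'I_n] == K]
                 | fixed_points f == set0]|%:R : rat).
  by congr (_%:R); apply: eq_card => f; rewrite !inE fixed_points_eq0.
rewrite IE; first last.
- move=> S SK; rewrite -card_surj_fixing_rStirling2 //.
  by apply: eq_card => f; rewrite !inE.
(* A fixed point is its own image, so it lies in [K]. *)
- move=> f; rewrite inE => /eqP <-; apply/subsetP => u; rewrite inE => /eqP <-.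
  exact: imset_f.
(* Inclusion-exclusion stops at k; the terms with k < r <= n vanish, since k blocks cannot separate
   r elements. *)
rewrite [in RHS](@big_cat_nat _ _ _ k.+1) //= [X in _ + X]big_nat_cond.
rewrite [X in _ + X]big1 ?addr0; last first.
  move=> r /andP[/andP[kr rn] _].
  by rewrite rStirling2_few_blocks ?mulr0.
rewrite big_mkord big_distrr /=; apply: eq_bigr => j _.
have jk : (j <= k)%N by rewrite -ltnS.
rewrite -mulr_natr -(bin_fact jk) !natrM.
by field; apply: natr_fact_neq0.
Qed.

(** * Abel summation and assembly over the images [k] *)

Lemma abel_summation (R : comPzRingType) (c s : nat -> R) n :
  \sum_(0 <= r < n) (\sum_(0 <= j < r.+1) c j) * (s r - s r.+1) =
    \sum_(0 <= r < n) c r * s r - (\sum_(0 <= j < n) c j) * s n.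
Proof.
elim: n => [|n IH]; first by rewrite !big_nil mul0r subr0.
by rewrite !(big_nat_recr n) //= IH; ring.
Qed.

Lemma card_CayDer n :
  #|CayDer n|%:R = \sum_(0 <= k < n.+1)
    #|[set f : {ffun 'I_n -> 'I_n} | ([set f u | u : 'I_n] == [set j : 'I_n | j < k]%N)
       && fixed_point_free f]|%:R :> rat.
Proof.
rewrite -natr_sum big_mkord; congr (_%:R); rewrite -sum1_card.
(* A Cayley permutation with image [k] determines k as the size of its image, so it is counted
   once. *)
pose im (f : {ffun 'I_n -> 'I_n}) : 'I_n.+1 := inord #|[set f u | u : 'I_n]|.
rewrite (partition_big im xpredT) //; apply: eq_bigr => k _.
rewrite sum1dep_card; apply: eq_card => f; rewrite !inE andbAC; congr (_ && _).
apply/andP/idP => [[/existsP[l /eqP im_f] /eqP <-]|/eqP im_f].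
  by rewrite /im im_f card_initial_segment ?inord_val // -ltnS.
split; first by apply/existsP; exists k; rewrite im_f.
by rewrite /im im_f card_initial_segment ?inord_val // -ltnS.
Qed.

Theorem theorem5p6 (n : nat) :
  (#|CayDer n|%:R : rat) =
    \sum_(0 <= r < n.+1)
      (#|Der r|%:R / (r`!)%:R) *
      \sum_(0 <= i < n.+1) (i`!)%:R * (rStirling2_diff r n i)%:~R.
Proof.
under [RHS]eq_bigr do rewrite big_distrr /=.
(* With the sums exchanged, the index i on the right is the image size, and the sides are compared
   for each k. *)
rewrite card_CayDer exchange_big /=; apply: eq_big_nat => k /andP[_ kn].
rewrite card_fpf_surj //.
transitivity (k`!%:R * \sum_(0 <= r < n.+1) (\sum_(0 <= j < r.+1) (-1) ^+ j / j`!%:R) *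
    ((rStirling2 r n k)%:R - (rStirling2 r.+1 n k)%:R) : rat).
  rewrite (abel_summation _ (fun r => (rStirling2 r n k)%:R)).
  (* The boundary term of the Abel summation carries [rStirling2 n.+1 n k], which is 0 by
     convention. *)
  by rewrite (@rStirling2_small n.+1) // mulr0 subr0.
rewrite big_distrr /=; apply: eq_bigr => r _.
by rewrite card_Der /rStirling2_diff rmorphB /= mulrCA.
Qed.
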